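(* For any $N\times N$ unitary matrix $U$ and any $N\times N$ unitary diagonal matrices $D_r,D_c$, $$\mathbf d(D_r\cdot U\cdot D_c)=\mathbf d(U).$$
   Context: Let $f$ be the map sending a complex $N\times N$ matrix $U$ to the real matrix $(|U_{i,j}|^2)_{i,j}$, regarded as a smooth map between real vector spaces, with differential at $U$ given by $Df_U(V)=\big(2\,\mathrm{Re}(\overline{U_{i,j}}V_{i,j})\big)_{i,j}$. For an $N\times N$ unitary matrix $U$ let $T_U=\{EU: E\in\mathbb C^{N\times N},\ E^*=-E\}$ be the (real) tangent space at $U$ to the manifold of unitary matrices. The defect of $U$ is the integer $\mathbf d(U)=(N-1)^2-\dim_{\mathbb R}Df_U(T_U)$. *)

(* Defs.v *)
From HB Require Import structures.
From mathcomp Require Import all_boot all_order all_algebra.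
From mathcomp Require Import all_classical all_reals all_analysis.
From mathcomp Require Import ring.
From mathcomp Require Import sesquilinear spectral.
From mathcomp.real_closed Require Import complex.
Set Implicit Arguments.
Unset Strict Implicit.
Unset Printing Implicit Defensive.
Import Order.TTheory GRing.Theory Num.Theory numFieldNormedType.Exports.
Local Open Scope ring_scope.
Local Open Scope complex_scope.
Local Open Scope sesquilinear_scope.

(* The space of complex n x n matrices regarded as a vector space over the
   reals; the alias is needed because 'M[R[i]]_n canonically carries its
   complex vector space structure. *)
Definition realified_mx (R : realType) (n : nat) : Type := 'M[R[i]]_n.

Section RealifiedMx.
Variables (R : realType) (n : nat).
Local Notation V := (realified_mx R n).

HB.instance Definition _ := GRing.Zmodule.on V.

Definition realified_scale (a : R) (A : V) : V := a%:C *: (A : 'M[R[i]]_n).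

Fact realified_scaleA a b A :
  realified_scale a (realified_scale b A) = realified_scale (a * b) A.
Proof. by rewrite /realified_scale scalerA rmorphM. Qed.

Fact realified_scale1 : left_id 1 realified_scale.
Proof. by move=> A; rewrite /realified_scale rmorph1 scale1r. Qed.

Fact realified_scaleDr : right_distributive realified_scale +%R.
Proof. by move=> a A B; rewrite /realified_scale scalerDr. Qed.

Fact realified_scaleDl A : {morph realified_scale^~ A : a b / a + b}.
Proof. by move=> a b; rewrite /realified_scale rmorphD scalerDl. Qed.

HB.instance Definition _ := GRing.Zmodule_isLmodule.Build R V
  realified_scaleA realified_scale1 realified_scaleDr realified_scaleDl.

Lemma realified_scaleE (a : R) (A : V) i j : (a *: A) i j = a%:C * A i j.
Proof. by rewrite [LHS]mxE. Qed.

Definition realified_split (A : V) : 'rV[R]_(n * n + n * n) :=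
  row_mx (mxvec (map_mx (@complex.Re R) A)) (mxvec (map_mx (@complex.Im R) A)).

Fact realified_vect_iso : Vector.axiom (n * n + n * n) V.
Proof.
exists realified_split.
  move=> a A B; apply/rowP=> k; rewrite !mxE.
  case: (fintype.split k) => k'; case/mxvec_indexP: k' => i j; rewrite !mxvecE !mxE.
    by case: (A i j) (B i j) => [x y] [z t] /=;
       rewrite mul0r subr0.
  by case: (A i j) (B i j) => [x y] [z t] /=;
     rewrite mul0r addr0.
exists (fun v => \matrix_(i, j)
   ((vec_mx (lsubmx v)) i j +i* (vec_mx (rsubmx v)) i j)) => [A|v].
  apply/matrixP=> i j; rewrite mxE /realified_split row_mxKl row_mxKr !mxvecK.
  by rewrite !mxE; case: (A i j).
rewrite /realified_split -[RHS]hsubmxK; congr row_mx.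
  by rewrite -[RHS]vec_mxK; congr mxvec; apply/matrixP=> i j; rewrite !mxE.
by rewrite -[RHS]vec_mxK; congr mxvec; apply/matrixP=> i j; rewrite !mxE.
Qed.

HB.instance Definition _ := Lmodule_hasFinDim.Build R V realified_vect_iso.

End RealifiedMx.

Section Defect.
Variables (R : realType) (n : nat).
Implicit Types U E V : realified_mx R n.

Definition sqmod_mx U : 'M[R]_n := \matrix_(i, j) (Normc.normc (U i j)) ^+ 2.

Definition Dsqmod_mx U V : 'M[R]_n :=
  \matrix_(i, j) (2 * complex.Re ((U i j)^*%C * V i j)).

Fact Dsqmod_mx_is_linear U : linear (Dsqmod_mx U).
Proof.
move=> a A B; apply/matrixP=> i j; rewrite !mxE.
case: (U i j) (A i j) (B i j) => [u u'] [x y] [z t] /=.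
by rewrite !mul0r subr0 addr0; ring.
Qed.

HB.instance Definition _ U :=
  GRing.isLinear.Build R (realified_mx R n) 'M[R]_n *:%R (Dsqmod_mx U)
    (Dsqmod_mx_is_linear U).

(* Dsqmod_mx U V is the derivative of sqmod_mx at U in the direction V. *)
Lemma is_derive_sqmod_mx U V i j :
  is_derive (0 : R) 1 (fun t : R => sqmod_mx (U + t *: V) i j)
    (Dsqmod_mx U V i j).
Proof.
have -> : (fun t : R => sqmod_mx (U + t *: V) i j) =
    (fun t : R => (complex.Re (U i j) + t * complex.Re (V i j)) ^+ 2
                 + (complex.Im (U i j) + t * complex.Im (V i j)) ^+ 2).
  apply/funext => t; rewrite !mxE.
  case: (U i j) (V i j) => [u u'] [v v'] /=.
  by rewrite sqr_sqrtr ?addr_ge0 ?sqr_ge0 // !mul0r subr0 addr0.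
rewrite mxE; case: (U i j) (V i j) => [u u'] [v v'] /=.
apply: is_derive_eq.
rewrite /GRing.scale /=; ring.
Qed.

Definition herm_part E : realified_mx R n :=
  E + ((E : 'M[R[i]]_n) ^t* : 'M[R[i]]_n).

Definition rmul_mx U E : realified_mx R n :=
  (E : 'M[R[i]]_n) *m (U : 'M[R[i]]_n).

Fact herm_part_is_linear : linear herm_part.
Proof.
move=> a A B; apply/matrixP=> i j; rewrite !mxE.
have aC : Num.conj (a%:C : R[i]) = a%:C by exact: conjc_real.
rewrite rmorphD rmorphM /= aC.
by rewrite mulrDr addrACA.
Qed.

HB.instance Definition _ :=
  GRing.isLinear.Build R (realified_mx R n) (realified_mx R n) *:%R herm_part
    herm_part_is_linear.

Fact rmul_mx_is_linear U : linear (rmul_mx U).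
Proof.
move=> a A B; rewrite /rmul_mx.
by rewrite [LHS](mulmxDl (a%:C *: (A : 'M[R[i]]_n)) B) -scalemxAl.
Qed.

HB.instance Definition _ U :=
  GRing.isLinear.Build R (realified_mx R n) (realified_mx R n) *:%R (rmul_mx U)
    (rmul_mx_is_linear U).

Definition skew_herm : {vspace realified_mx R n} := lker (linfun herm_part).

Definition tangent U : {vspace realified_mx R n} :=
  (linfun (rmul_mx U) @: skew_herm)%VS.

Lemma mem_skew_herm E :
  (E \in skew_herm) = ((E : 'M[R[i]]_n) ^t* == - (E : 'M[R[i]]_n)).
Proof. by rewrite memv_ker lfunE /= /herm_part addrC addr_eq0. Qed.

Lemma tangentP U V :
  reflect (exists2 E : 'M[R[i]]_n,
             E ^t* = - E & V = E *m (U : 'M[R[i]]_n))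
          (V \in tangent U).
Proof.
apply: (iffP memv_imgP) => [[E sE ->]|[E sE ->]]; exists E.
- by apply/eqP; rewrite -mem_skew_herm.
- by rewrite lfunE.
- by rewrite mem_skew_herm sE.
- by rewrite lfunE.
Qed.

Definition defect U : int :=
  (n%:Z - 1) ^+ 2 - (\dim (linfun (Dsqmod_mx U) @: tangent U)%VS)%:Z.

End Defect.

(* Main.v *)
(* Writing U' = Dr U Dc, a tangent vector E U at U corresponds to the tangent
   vector (Dr E Dr^* ) U' = Dr (E U) Dc at U', and Df_{U'} and Df_U agree on
   these since the phases cancel entrywise. Hence Df_U(T_U) is contained in
   Df_{U'}(T_{U'}); the converse inclusion is the same one for Dr^* and Dc^*. *)
Require Import Defs.
From mathcomp Require Import all_boot all_order all_algebra.
From mathcomp Require Import reals spectral.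
From mathcomp.real_closed Require Import complex.
From mathcomp Require Import sesquilinear ring.
Import Order.TTheory GRing.Theory Num.Theory.
Local Open Scope ring_scope.
Local Open Scope complex_scope.

Lemma is_diag_adjmx (C : numClosedFieldType) n (D : 'M[C]_n) :
  is_diag_mx D -> is_diag_mx (D ^t*)%sesqui.
Proof.
move=> /is_diag_mxP dD; apply/is_diag_mxP => i j ij.
by rewrite !mxE dD ?conjC0 // eq_sym.
Qed.

(** In entry [(i, i)] of [D D^* = 1], diagonality leaves only the term [k = i] of the sum. *)
Lemma unitary_diag_entry (C : numClosedFieldType) n (D : 'M[C]_n) i :
  D \is unitarymx -> is_diag_mx D -> (D i i)^* * D i i = 1.
Proof.
move=> /unitarymxP uD /is_diag_mxP dD.
have /matrixP/(_ i i) := uD; rewrite !mxE eqxx (bigD1 i) //= big1 => [|k ki].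
  by rewrite !mxE addr0 mulrC.
by rewrite dD ?mul0r // eq_sym.
Qed.

Lemma diag_mulmx_diagE (C : pzRingType) n (D V D' : 'M[C]_n) i j :
  is_diag_mx D -> is_diag_mx D' ->
  (D *m V *m D') i j = D i i * V i j * D' j j.
Proof.
move=> /is_diag_mxP dD /is_diag_mxP dD'.
rewrite mxE (bigD1 j) //= big1 ?addr0 => [|k kj]; last by rewrite dD' ?mulr0.
congr (_ * _); rewrite mxE (bigD1 i) //= big1 ?addr0 // => k ki.
by rewrite dD ?mul0r // eq_sym.
Qed.

Lemma Dsqmod_mx_unitary_diag (R : realType) n (U V D D' : 'M[R[i]]_n) :
  D \is unitarymx -> is_diag_mx D -> D' \is unitarymx -> is_diag_mx D' ->
  Dsqmod_mx (D *m U *m D') (D *m V *m D') = Dsqmod_mx U V.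
Proof.
move=> uD dD uD' dD'; apply/matrixP => i j.
rewrite [LHS]mxE [RHS]mxE !diag_mulmx_diagE // !rmorphM /=.
have eD := unitary_diag_entry _ _ _ i uD dD; have eD' := unitary_diag_entry _ _ _ j uD' dD'.
congr (2 * complex.Re _).
(* Write the missing phases into the right side as factors 1; both sides then agree by
   commutativity. *)
rewrite -[RHS]mul1r -[in RHS]eD -[RHS]mulr1 -[in RHS]eD'.
ring.
Qed.

Lemma Dsqmod_tangent_sub (R : realType) n (U D D' : 'M[R[i]]_n) :
  D \is unitarymx -> is_diag_mx D -> D' \is unitarymx -> is_diag_mx D' ->
  (linfun (Dsqmod_mx U) @: tangent U <=
   linfun (Dsqmod_mx (D *m U *m D')) @: tangent (D *m U *m D'))%VS.
Proof.
move=> uD dD uD' dD'.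
apply/subvP => W /memv_imgP[V /tangentP[E sE ->] ->].
apply/memv_imgP; exists (D *m (E *m U) *m D'); last first.
  by rewrite !lfunE /= Dsqmod_mx_unitary_diag.
(* Conjugation by [D] preserves skew-Hermitian matrices, and the inner [D^* D] cancels against
   [D *m U *m D']. *)
apply/tangentP; exists (D *m E *m (D ^t*)%sesqui).
  rewrite !trmx_mul !map_mxM /= map_trmx trmxK -map_mx_comp.
  rewrite map_mx_id; last exact: conjCK.
  by rewrite sE mulNmx mulmxN mulmxA.
by rewrite !mulmxA mulmxKtV.
Qed.

Theorem lemma3p2 (R : realType) (n : nat) (U Dr Dc : 'M[R[i]]_n)
    (unitaryU : U \is unitarymx)
    (unitaryDr : Dr \is unitarymx) (diagDr : is_diag_mx Dr)
    (unitaryDc : Dc \is unitarymx) (diagDc : is_diag_mx Dc) :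
  defect (Dr *m U *m Dc) = defect U.
Proof.
(* The two images coincide as subspaces, not only in dimension. *)
congr (_ - Posz (\dim _)); apply/eqP; rewrite eqEsubv.
apply/andP; split; last exact: Dsqmod_tangent_sub.
(* The adjoints are again unitary and diagonal, and [Dr^* (Dr U Dc) Dc^*] collapses to [U]. *)
have := @Dsqmod_tangent_sub R n (Dr *m U *m Dc) (Dr ^t*)%sesqui (Dc ^t*)%sesqui.
rewrite !trmxC_unitary !is_diag_adjmx //.
rewrite !mulmxA (mulmx1C (unitarymxP unitaryDr)) mul1mx mulmxtVK //.
by move=> ->.
Qed.
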